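(* Let $K$ be a division ring and $S=K[\underline{t};\sigma,\underline{\delta}]$ a multivariate Ore extension in $n$ variables. Suppose that $\sigma=\mathrm{diag}(\sigma_1,\dots,\sigma_n)$ and that, for some $1\le i\le n$, there is no nonzero polynomial $q(t_i)\in S_i=K[t_i;\sigma_i,\delta_i]$ such that $q(a)=0$ for every $a\in K$. Then $p_i(t_i)\in S_i$ is semi-invariant if and only if, for every $a\in K$, $$p_i(T_a)=r_{p_i(T_a)(1)}\circ\sigma_i^{n_i},$$ where $n_i=\deg(p_i(t_i))$ and $r_{p_i(T_a)(1)}$ stands for the right multiplication by $p_i(T_a)(1)$.
   Context: All rings are associative with identity. Here $\sigma=\mathrm{diag}(\sigma_1,\dots,\sigma_n)$ means that $\sigma:K\to M_n(K)$ is the ring homomorphism $\sigma(a)=\mathrm{diag}(\sigma_1(a),\dots,\sigma_n(a))$ with each $\sigma_j$ a ring endomorphism of $K$, and $\underline{\delta}=(\delta_1,\dots,\delta_n)^t$ where each $\delta_j:K\to K$ is a $\sigma_j$-derivation, i.e. additive with $\delta_j(ab)=\sigma_j(a)\delta_j(b)+\delta_j(a)b$. The ring $S=K[\underline{t};\sigma,\underline{\delta}]$ is the ring of (finite) sums $\sum_m\alpha_m m$, $\alpha_m\in K$, $m$ in the free monoid on $t_1,\dots,t_n$, with multiplication determined by concatenation and $t_ja=\sigma_j(a)t_j+\delta_j(a)$. It contains the one-variable Ore extension $S_i=K[t_i;\sigma_i,\delta_i]$, whose elements are the polynomials $\sum_k \alpha_k t_i^k$ with coefficients on the left. A nonzero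 polynomial $p\in S$ is (right) semi-invariant if for any $a\in K$ there exists $a'\in K$ with $p\,a=a'p$. For $q(t_i)\in S_i$ and $a\in K$, the evaluation $q(a)$ is the unique element of $K$ such that $q(t_i)-q(a)\in S_i(t_i-a)$. For $a\in K$, $T_a:K\to K$ is the additive map $T_a(x)=\sigma_i(x)a+\delta_i(x)$, and for $q=\sum_k\alpha_kt_i^k\in S_i$, $q(T_a)\in\mathrm{End}(K,+)$ is the map $x\mapsto\sum_k\alpha_kT_a^k(x)$.
   Formalization: ''Only if'' fails for non-monic p_i (real quaternions, sigma=id, delta=0, p=i), so it is proved when the leading coefficient of p_i commutes with sigma_i^{n_i}(K), e.g. p_i monic; ''if'' is proved for every nonzero p_i. p_i is taken nonzero so that n_i is defined. *)

(* Defs.v *)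
From HB Require Import structures.
From mathcomp Require Import all_boot all_order all_algebra.
From mathcomp Require Import xfinmap monalg.

Set Implicit Arguments.
Unset Strict Implicit.
Unset Printing Implicit Defensive.

Import GRing.Theory.
Local Open Scope ring_scope.

(* [K : unitRingType] together with [GRing.field_axiom K] (every nonzero      *)
(* element is a unit) is a division ring: commutativity is not assumed.       *)

Record skew_derivation (K : pzRingType) (s : K -> K) := SkewDerivation {
  skewder_fun :> K -> K;
  skewderD : forall a b, skewder_fun (a + b) = skewder_fun a + skewder_fun b;
  skewderM : forall a b,
    skewder_fun (a * b) = s a * skewder_fun b + skewder_fun a * b }.

(* The finite sums [\sum_w c_w w], where [w] ranges over the words            *)
(* [seq 'I_n], i.e. over the free monoid on t_0, ..., t_(n-1).                *)
(* The product is the one determined by t_j a = sigma_j(a) t_j + delta_j(a).  *)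
Definition mvore (K : nzRingType) (n : nat) (sigma : 'I_n -> {rmorphism K -> K})
    (delta : forall j, skew_derivation (sigma j)) : Type :=
  {malg K[seq 'I_n]}.

Section MvOreRing.
Variables (K : nzRingType) (n : nat) (sigma : 'I_n -> {rmorphism K -> K}).
Variable delta : forall j, skew_derivation (sigma j).

Local Notation S := (mvore delta).

HB.instance Definition _ := GRing.Lmodule.copy S {malg K[seq 'I_n]}.

Implicit Types (f g h : S) (c d : K) (w : seq 'I_n) (j : 'I_n).

Definition mvmon c w : S := << c *g w >>.

Lemma mvmonD w : {morph mvmon^~ w : c d / c + d}.
Proof. by move=> c d; apply: monalgUD. Qed.

Lemma mvmon0 w : mvmon 0 w = 0.
Proof. exact: monalgU0. Qed.

Lemma mvmonZ c d w : c *: mvmon d w = mvmon (c * d) w.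
Proof.
apply/malgP=> k; rewrite /mvmon (@mcoeffZ _ _ c << d *g w >> k) !mcoeffU.
by case: eqP; rewrite /= ?mulr1n ?mulr0n ?mulr0.
Qed.

Lemma mvore_ind (P : S -> Prop) :
  P 0 -> (forall f g, P f -> P g -> P (f + g)) -> (forall c w, P (mvmon c w)) ->
  forall f, P f.
Proof.
move=> P0 PD PU f; rewrite [f]monalgE.
elim: (enum_fset _) => [|w r IH]; first by rewrite big_nil.
by rewrite big_cons; apply: PD IH; apply: PU.
Qed.

(* Additive extension to S of [c w |-> F w c]. *)
Definition mvext (F : seq 'I_n -> K -> S) f : S :=
  \sum_(w <- msupp f) F w (mcoeff w f).

Section Ext.
Variable F : seq 'I_n -> K -> S.
Hypothesis FD : forall w, {morph F w : c d / c + d}.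

Let F0 w : F w 0 = 0.
Proof. by apply: (addrI (F w 0)); rewrite -FD !addr0. Qed.

Lemma mvextEw (D : {fset seq 'I_n}) f : (msupp f `<=` D)%fset ->
  mvext F f = \sum_(w <- D) F w (mcoeff w f).
Proof.
move=> sD; rewrite /mvext; apply: big_fset_incl => // w _ /mcoeff_outdom ->.
exact: F0.
Qed.

Lemma mvextD : {morph mvext F : f g / f + g}.
Proof.
move=> f g.
rewrite (@mvextEw (msupp f `|` msupp g)%fset (f + g)); last exact: msuppD_le.
rewrite (@mvextEw (msupp f `|` msupp g)%fset f) ?fsubsetUl //.
rewrite (@mvextEw (msupp f `|` msupp g)%fset g) ?fsubsetUr //.
rewrite -big_split; apply: eq_bigr => w _ /=.
by rewrite -FD; congr (F w _); apply: mcoeffD.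
Qed.

Lemma mvext0 : mvext F 0 = 0.
Proof. by apply: (addrI (mvext F 0)); rewrite -mvextD !addr0. Qed.

Lemma mvextU c w : mvext F (mvmon c w) = F w c.
Proof.
rewrite (@mvextEw [fset w]%fset); last exact: msuppU_le.
by rewrite big_seq_fset1 mcoeffUU.
Qed.

End Ext.

(* Left multiplication by t_j: c w |-> sigma_j(c) (t_j w) + delta_j(c) w. *)
Definition mvlmulX j : S -> S :=
  mvext (fun w c => mvmon (sigma j c) (j :: w) + mvmon (delta j c) w).

Definition mvlmulw w f : S := foldr mvlmulX f w.

Lemma mvlmulw_cons j w f : mvlmulw (j :: w) f = mvlmulX j (mvlmulw w f).
Proof. by []. Qed.

Definition mvmul f g : S := mvext (fun w c => c *: mvlmulw w g) f.

Definition mvone : S := mvmon 1 [::].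

Lemma mvlmulXD j : {morph mvlmulX j : f g / f + g}.
Proof.
by apply: mvextD => w c d; rewrite rmorphD skewderD !mvmonD addrACA.
Qed.

Lemma mvlmulX0 j : mvlmulX j 0 = 0.
Proof. by apply: (addrI (mvlmulX j 0)); rewrite -mvlmulXD !addr0. Qed.

Lemma mvlmulXU j c w :
  mvlmulX j (mvmon c w) = mvmon (sigma j c) (j :: w) + mvmon (delta j c) w.
Proof.
by rewrite /mvlmulX mvextU // => v a b; rewrite rmorphD skewderD !mvmonD addrACA.
Qed.

Lemma mvlmulXZ j c f : mvlmulX j (c *: f) = sigma j c *: mvlmulX j f + delta j c *: f.
Proof.
elim/mvore_ind: f => [|f g IHf IHg|d w].
- by rewrite scaler0 mvlmulX0 !scaler0 addr0.
- by rewrite scalerDr !mvlmulXD IHf IHg !scalerDr addrACA.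
- rewrite mvmonZ !mvlmulXU rmorphM skewderM scalerDr !mvmonZ mvmonD.
  by rewrite addrA.
Qed.

Lemma mvlmulwD w : {morph mvlmulw w : f g / f + g}.
Proof. by elim: w => // j w IH f g; rewrite !mvlmulw_cons IH mvlmulXD. Qed.

Let scaleD g w : {morph (fun c => c *: mvlmulw w g) : c d / c + d}.
Proof. by move=> c d /=; rewrite scalerDl. Qed.

Lemma mvmulDl : left_distributive mvmul +%R.
Proof. by move=> f g h; apply: (mvextD (scaleD h)). Qed.

Lemma mvmul0 g : mvmul 0 g = 0.
Proof. exact: (mvext0 (scaleD g)). Qed.

Lemma mvmulU c w g : mvmul (mvmon c w) g = c *: mvlmulw w g.
Proof. exact: (mvextU (scaleD g)). Qed.

Lemma mvmulDr : right_distributive mvmul +%R.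
Proof.
move=> f g h; elim/mvore_ind: f => [|f1 f2 IH1 IH2|c w].
- by rewrite !mvmul0 addr0.
- by rewrite !mvmulDl IH1 IH2 addrACA.
- by rewrite !mvmulU mvlmulwD scalerDr.
Qed.

Lemma mvmulZl c f g : c *: mvmul f g = mvmul (c *: f) g.
Proof.
elim/mvore_ind: f => [|f1 f2 IH1 IH2|d w].
- by rewrite scaler0 !mvmul0 scaler0.
- by rewrite mvmulDl !scalerDr IH1 IH2 mvmulDl.
- by rewrite mvmonZ !mvmulU scalerA.
Qed.

Lemma mvmulXl j f g : mvmul (mvlmulX j f) g = mvlmulX j (mvmul f g).
Proof.
elim/mvore_ind: f => [|f1 f2 IH1 IH2|c w].
- by rewrite mvlmulX0 !mvmul0 mvlmulX0.
- by rewrite mvlmulXD !mvmulDl mvlmulXD IH1 IH2.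
- by rewrite mvlmulXU mvmulDl !mvmulU /= mvlmulXZ.
Qed.

Lemma mvmulA : associative mvmul.
Proof.
move=> f g h; elim/mvore_ind: f => [|f1 f2 IH1 IH2|c w].
- by rewrite !mvmul0.
- by rewrite !mvmulDl IH1 IH2.
- rewrite !mvmulU -mvmulZl; congr (c *: _).
  by elim: w => //= j w ->; rewrite mvmulXl.
Qed.

Lemma mvmul1l : left_id mvone mvmul.
Proof. by move=> f; rewrite mvmulU scale1r. Qed.

Lemma skewder1 j : delta j 1 = 0.
Proof.
apply: (addrI (delta j 1)); rewrite addr0.
by rewrite -[RHS](congr1 (delta j) (mulr1 1)) skewderM rmorph1 mul1r mulr1.
Qed.

Lemma mvlmulw1 w : mvlmulw w mvone = mvmon 1 w.
Proof.
by elim: w => //= j w ->; rewrite mvlmulXU rmorph1 skewder1 mvmon0 addr0.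
Qed.

Lemma mvmul1r : right_id mvone mvmul.
Proof.
elim/mvore_ind => [|f g IHf IHg|c w]; first exact: mvmul0.
  by rewrite mvmulDl IHf IHg.
by rewrite mvmulU mvlmulw1 mvmonZ mulr1.
Qed.

Lemma mvone_neq0 : mvone != 0.
Proof. by apply/eqP=> /eqP; rewrite [_ == _]monalgU_eq0 oner_eq0. Qed.

HB.instance Definition _ := GRing.Zmodule_isNzRing.Build S
  mvmulA mvmul1l mvmul1r mvmulDl mvmulDr mvone_neq0.

HB.instance Definition _ := GRing.Lmodule_isLalgebra.Build K S mvmulZl.

End MvOreRing.

Section OneVariable.
Variables (K : nzRingType) (n : nat) (sigma : 'I_n -> {rmorphism K -> K}).
Variable delta : forall j, skew_derivation (sigma j).

Local Notation S := (mvore delta).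

Definition mvX (j : 'I_n) : S := mvmon delta 1 [:: j].

(* K is embedded in S as [a%:A], the constant a. *)
Lemma mvX_comm j (a : K) :
  mvX j * a%:A = (sigma j a)%:A * mvX j + (delta j a)%:A.
Proof.
rewrite -scalerAl mul1r.
have Amon c : c%:A = mvmon delta c [::].
  by rewrite -[1]/(mvone delta) /mvone mvmonZ mulr1.
rewrite -[LHS]/(mvmul (mvmon delta 1 [:: j]) a%:A) mvmulU scale1r /=.
by rewrite !Amon mvlmulXU /mvX mvmonZ mulr1.
Qed.

Variable i : 'I_n.

(* The elements of S_i are the [uniore i q], for q : {poly K} the list of     *)
(* left coefficients. Only the left K-module structure of {poly K} is         *)
(* relevant: its product, in which 'X is central, is not the product of S_i.  *)
Definition uniore (q : {poly K}) : S := \sum_(k < size q) q`_k *: mvX i ^+ k.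

(* q(a) = b, i.e. q(t_i) - b \in S_i (t_i - a). *)
Definition uniore_eval (q : {poly K}) (a b : K) : Prop :=
  exists g : {poly K}, uniore q - b%:A = uniore g * (mvX i - a%:A).

Definition pseudolin (a x : K) : K := sigma i x * a + delta i x.

(* The operator q(T_a), where T_a is [pseudolin a]. *)
Definition uniore_op (q : {poly K}) (a x : K) : K :=
  \sum_(k < size q) q`_k * iter k (pseudolin a) x.

End OneVariable.

Definition semi_invariant (K : nzRingType) (n : nat)
    (sigma : 'I_n -> {rmorphism K -> K})
    (delta : forall j, skew_derivation (sigma j)) (p : mvore delta) : Prop :=
  p != 0 /\ forall a : K, exists a' : K, p * a%:A = a'%:A * p.

(* Main.v *)
Require Import Defs.
From mathcomp Require Import all_boot all_order all_algebra.
From mathcomp Require Import monalg.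

Set Implicit Arguments.
Unset Strict Implicit.
Unset Printing Implicit Defensive.

Import GRing.Theory.
Local Open Scope ring_scope.

(* The additive group K is a left S_i-module on which t_i acts as T_a, and    *)
(* q(a) = q(T_a)(1) by right division by t_i - a. Hence                       *)
(* p(T_a)(x) = (p x)(T_a)(1) = (p x)(a). If p x = x' p, comparing leading     *)
(* coefficients gives x' = sigma_i^n_i(x), since the leading coefficient of p *)
(* commutes with sigma_i^n_i(x), and evaluating both sides at a is the        *)
(* formula. Conversely, the formula says that p x - sigma_i^n_i(x) p vanishes *)
(* at every a, so that it is zero by hypothesis.                              *)

(** Two identities carry both directions: q(a) = q(T_a)(1) ([uniore_evalE]), and p x acts on K as
    p(T_a) after left multiplication by x ([uniore_op_rmulC]). By [uniore_inj], equalities in S_i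
    can be read on left coefficients. If p has leading coefficient c and p x = x' p, then
    [coef_rmulC_lead] gives c sigma_i^n_i(x) = x' c; the commutation assumption of the forward
    direction turns this into x' = sigma_i^n_i(x). *)

Lemma opprD_split (V : zmodType) (x y z : V) : - (y + z) = - (x + z) + (x - y).
Proof. by rewrite [- (x + z)]opprD [- x - z]addrC addrA addrNK opprD addrC. Qed.

Section OneVariableOre.
Variables (K : nzRingType) (n : nat) (sigma : 'I_n -> {rmorphism K -> K}).
Variables (delta : forall j, skew_derivation (sigma j)) (i : 'I_n).

Local Notation S := (mvore delta).
Local Notation t := (mvX delta i).
Local Notation uni := (uniore delta i).
Local Notation op := (uniore_op delta i).
Local Notation T := (pseudolin delta i).

Implicit Types (p q g : {poly K}) (a x c : K) (k m : nat).

Lemma skewder0 : delta i 0 = 0.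
Proof. by apply: (addrI (delta i 0)); rewrite -skewderD !addr0. Qed.

Lemma pseudolinD a : {morph T a : x y / x + y}.
Proof. by move=> x y; rewrite /pseudolin rmorphD skewderD mulrDl addrACA. Qed.

Lemma pseudolin0 a : T a 0 = 0.
Proof. by rewrite /pseudolin rmorph0 skewder0 mul0r addr0. Qed.

(** This is the relation t_i c = sigma_i(c) t_i + delta_i(c) seen on K: it makes K a left
    S_i-module. *)
Lemma pseudolinM a c x : T a (c * x) = sigma i c * T a x + delta i c * x.
Proof. by rewrite /pseudolin rmorphM skewderM mulrDr !mulrA addrA. Qed.

Lemma uniore_wide m q : (size q <= m)%N -> uni q = \sum_(k < m) q`_k *: t ^+ k.
Proof.
move=> le_q_m; rewrite /uniore (big_ord_widen _ (fun k => q`_k *: t ^+ k) le_q_m).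
rewrite big_mkcond /=; apply: eq_bigr => k _; case: ltnP => // le_q_k.
by rewrite nth_default ?scale0r.
Qed.

Lemma uniore_op_wide m q a x :
  (size q <= m)%N -> op q a x = \sum_(k < m) q`_k * iter k (T a) x.
Proof.
move=> le_q_m.
rewrite /uniore_op (big_ord_widen _ (fun k => q`_k * iter k (T a) x) le_q_m).
rewrite big_mkcond /=; apply: eq_bigr => k _; case: ltnP => // le_q_k.
by rewrite nth_default ?mul0r.
Qed.

Lemma unioreD : {morph uni : p q / p + q}.
Proof.
move=> p q; pose m := maxn (size p) (size q).
rewrite (uniore_wide (size_polyD p q)) (@uniore_wide m p) ?leq_maxl //.
rewrite (@uniore_wide m q) ?leq_maxr // -big_split /=.
by apply: eq_bigr => k _; rewrite coefD scalerDl.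
Qed.

Lemma uniore0 : uni 0 = 0.
Proof. by rewrite /uniore size_poly0 big_ord0. Qed.

Lemma unioreZ c q : uni (c *: q) = c *: uni q.
Proof.
rewrite (uniore_wide (size_scale_leq c q)) /uniore scaler_sumr.
by apply: eq_bigr => k _; rewrite coefZ scalerA.
Qed.

Lemma unioreC c : uni c%:P = c%:A.
Proof.
by rewrite (uniore_wide (size_polyC_leq1 c)) big_ord1 coefC expr0.
Qed.

Lemma uniore_opD a x : {morph op^~ a ^~ x : p q / p + q}.
Proof.
move=> p q; pose m := maxn (size p) (size q).
rewrite (uniore_op_wide a x (size_polyD p q)).
rewrite (@uniore_op_wide m p) ?leq_maxl //.
rewrite (@uniore_op_wide m q) ?leq_maxr // -big_split /=.
by apply: eq_bigr => k _; rewrite coefD mulrDl.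
Qed.

Lemma uniore_op0 a x : op 0 a x = 0.
Proof. by rewrite /uniore_op size_poly0 big_ord0. Qed.

Lemma uniore_opZ c q a x : op (c *: q) a x = c * op q a x.
Proof.
rewrite (uniore_op_wide a x (size_scale_leq c q)) /uniore_op mulr_sumr.
by apply: eq_bigr => k _; rewrite coefZ mulrA.
Qed.

Lemma uniore_opC c a x : op c%:P a x = c * x.
Proof.
by rewrite (uniore_op_wide a x (size_polyC_leq1 c)) big_ord1 coefC.
Qed.

Lemma mvX_mul (f : S) : t * f = mvlmulX i f.
Proof. by rewrite -[LHS]/(mvmul t f) mvmulU scale1r. Qed.

Lemma mvX_exp k : t ^+ k = mvmon delta 1 (nseq k i).
Proof.
elim: k => [//|k IHk].
by rewrite exprS IHk mvX_mul mvlmulXU rmorph1 skewder1 mvmon0 addr0.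
Qed.

(** The powers of t_i are distinct words of the monomial basis of S, told apart by their lengths. *)
Lemma mcoeff_uniore q k : mcoeff (nseq k i) (uni q) = q`_k.
Proof.
rewrite (@uniore_wide (maxn (size q) k.+1)) ?leq_maxl //.
have ltk : (k < maxn (size q) k.+1)%N by rewrite leq_max ltnSn orbT.
rewrite (eq_bigr (fun j : 'I__ => mvmon delta q`_j (nseq j i))); last first.
  by move=> j _; rewrite mvX_exp mvmonZ mulr1.
rewrite (bigD1 (Ordinal ltk)) //= /mvmon.
have cU c j : mcoeff (nseq k i) (<< c *g nseq j i >>) = c *+ (j == k).
  rewrite mcoeffU; congr (_ *+ nat_of_bool _).
  apply/eqP/eqP=> [/(congr1 size)|->//].
  by rewrite !size_nseq.
rewrite [LHS]mcoeffD cU eqxx [X in _ + X](_ : _ = 0) ?addr0 //.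
rewrite [LHS]raddf_sum big1 //= => j.
by rewrite cU -val_eqE /= => /negbTE->.
Qed.

Lemma uniore_inj : injective uni.
Proof.
by move=> p q eq_pq; apply/polyP=> k; rewrite -!mcoeff_uniore eq_pq.
Qed.

(* The coefficients of t_i q. *)
Definition lmulX q : {poly K} := map_poly (sigma i) q * 'X + map_poly (delta i) q.

Lemma coef_lmulX q k :
  (lmulX q)`_k = (if k == 0%N then 0 else sigma i q`_k.-1) + delta i q`_k.
Proof.
rewrite coefD coefMX (coef_map_id0 _ _ skewder0); case: eqP => // _.
by rewrite coef_map.
Qed.

Lemma size_lmulX q : (size (lmulX q) <= (size q).+1)%N.
Proof.
apply/leq_sizeP=> k ltk; rewrite coef_lmulX.
case: k ltk => // k; rewrite ltnS => lek /=.
by rewrite !nth_default ?rmorph0 ?skewder0 ?addr0 // leqW.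
Qed.

Lemma uniore_lmulX q : uni (lmulX q) = t * uni q.
Proof.
rewrite (uniore_wide (size_lmulX q)) (uniore_wide (leqnSn (size q))).
under eq_bigr do rewrite coef_lmulX scalerDl.
(* The sigma_i sum drops its zero term at 0, the other two their zero top term; all then run over
   [size q]. *)
rewrite big_split /= big_ord_recl /= scale0r add0r mulr_sumr.
rewrite [in RHS]big_ord_recr /= nth_default // scale0r mulr0 addr0.
rewrite [X in _ + X = _]big_ord_recr /= nth_default // skewder0 scale0r addr0.
rewrite -big_split /=; apply: eq_bigr => k _.
by rewrite mvX_mul mvlmulXZ -mvX_mul -exprS.
Qed.

Lemma uniore_op_lmulX q a x : op (lmulX q) a x = T a (op q a x).
Proof.
rewrite (uniore_op_wide a x (size_lmulX q)) (uniore_op_wide a x (leqnSn (size q))).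
under eq_bigr do rewrite coef_lmulX mulrDl.
rewrite big_split /= big_ord_recl /= mul0r add0r.
rewrite (big_morph _ (pseudolinD a) (pseudolin0 a)).
rewrite [in RHS]big_ord_recr /= nth_default // mul0r pseudolin0 addr0.
rewrite [X in _ + X = _]big_ord_recr /= nth_default // skewder0 mul0r addr0.
by rewrite -big_split /=; apply: eq_bigr => k _; rewrite pseudolinM.
Qed.

(* The coefficients of p x. *)
Definition rmulC p x : {poly K} :=
  \sum_(k < size p) p`_k *: iter k lmulX x%:P.

Lemma uniore_rmulC p x : uni (rmulC p x) = uni p * x%:A.
Proof.
rewrite /rmulC (big_morph _ unioreD uniore0) [in RHS]/uniore mulr_suml.
apply: eq_bigr => k _; rewrite unioreZ -scalerAl; congr (_ *: _).
elim: (k : nat) => [|m IHm] /=; first by rewrite unioreC mul1r.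
by rewrite uniore_lmulX IHm exprS mulrA.
Qed.

Lemma uniore_op_rmulC p x a y : op (rmulC p x) a y = op p a (x * y).
Proof.
rewrite /rmulC (big_morph _ (uniore_opD a y) (uniore_op0 a y)).
apply: eq_bigr => k _; rewrite uniore_opZ; congr (_ * _).
elim: (k : nat) => [|m IHm] /=; first by rewrite uniore_opC.
by rewrite uniore_op_lmulX IHm.
Qed.

Lemma size_iter_lmulX x k : (size (iter k lmulX x%:P) <= k.+1)%N.
Proof.
elim: k => [|k IHk] /=; first exact: size_polyC_leq1.
exact: leq_trans (size_lmulX _) _.
Qed.

(** Each factor t_i raises the degree only through sigma_i, so delta_i never reaches the top
    coefficient. *)
Lemma coef_iter_lmulX x k : (iter k lmulX x%:P)`_k = iter k (sigma i) x.
Proof.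
elim: k => [|k IHk]; first by rewrite coefC.
by rewrite /= coef_lmulX /= IHk nth_default ?size_iter_lmulX // skewder0 addr0.
Qed.

Lemma coef_rmulC_lead p x :
  (rmulC p x)`_(size p).-1 = lead_coef p * iter (size p).-1 (sigma i) x.
Proof.
rewrite /rmulC coef_sum lead_coefE; case def_n: (size p) => [|m] /=.
  (* For p = 0 both sides are 0. *)
  by rewrite big_ord0 nth_default ?def_n // mul0r.
rewrite big_ord_recr /= coefZ coef_iter_lmulX big1 ?add0r // => k _.
by rewrite coefZ [X in _ * X]nth_default ?mulr0 ?(leq_trans (size_iter_lmulX x k)).
Qed.

Lemma uniore_evalE q a : uniore_eval delta i q a (op q a 1).
Proof.
have evalX k : exists g, t ^+ k - (iter k (T a) 1)%:A = uni g * (t - a%:A).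
  elim: k => [|k [g IHg]] /=.
    by exists 0; rewrite uniore0 mul0r scale1r subrr.
  set b := iter k (T a) 1 in IHg *.
  (* t_i^(k+1) - T_a(b) = t_i (t_i^k - b) + (t_i b - T_a(b)), and the last bracket is sigma_i(b)
     (t_i - a). *)
  exists (lmulX g + (sigma i b)%:P).
  rewrite unioreD uniore_lmulX unioreC mulrDl -mulrA -IHg mulrBr mvX_comm.
  rewrite mulrBr -exprS -scalerAl mul1r -[(sigma i b)%:A * a%:A]scalerAl mul1r.
  rewrite scalerA /pseudolin scalerDl -addrA; congr (_ + _).
  exact: opprD_split.
(* S_i (t_i - a) is closed under sums and left scalars, so the powers of t_i suffice. *)
suff [g def_g] : exists g, \sum_(k < size q) q`_k *: (t ^+ k - (iter k (T a) 1)%:A)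
                           = uni g * (t - a%:A).
  exists g; rewrite -def_g /uniore /uniore_op scaler_suml -sumrB.
  by apply: eq_bigr => k _; rewrite scalerBr scalerA.
elim/big_ind: _ => [|f1 f2 [g1 ->] [g2 ->]|k _].
- by exists 0; rewrite uniore0 mul0r.
- by exists (g1 + g2); rewrite unioreD mulrDl.
- by have [g ->] := evalX k; exists (q`_k *: g); rewrite unioreZ scalerAl.
Qed.

End OneVariableOre.

Theorem proposition4p7 (K : unitRingType) (Kdiv : GRing.field_axiom K)
    (n : nat) (sigma : 'I_n -> {rmorphism K -> K})
    (delta : forall j, skew_derivation (sigma j)) (i : 'I_n)
    (no_vanishing : ~ exists q : {poly K},
       q != 0 /\ forall a : K, uniore_eval delta i q a 0)
    (p : {poly K}) (p_neq0 : p != 0) :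
  let n_i := (size p).-1 in
  let op_formula := forall a : K,
    uniore_op delta i p a =1
      (fun y : K => y * uniore_op delta i p a 1) \o iter n_i (sigma i) in
  ((forall x : K, lead_coef p * iter n_i (sigma i) x
                  = iter n_i (sigma i) x * lead_coef p) ->
   (semi_invariant (uniore delta i p) <-> op_formula))
  /\ (op_formula -> semi_invariant (uniore delta i p)).
Proof.
move=> n_i op_formula.
have scalarM c (f : mvore delta) : c%:A * f = c *: f by rewrite -scalerAl mul1r.
have op_semi : op_formula -> semi_invariant (uniore delta i p).
  move=> opE; split.
    by apply: contraNneq p_neq0; rewrite -(uniore0 delta i) => /uniore_inj->.
  move=> x; exists (iter n_i (sigma i) x).
  rewrite -uniore_rmulC scalarM -unioreZ; congr (uniore _ _ _).
  apply/eqP; rewrite -subr_eq0; apply/negPn/negP => q_neq0.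
  apply: no_vanishing; eexists; split; first exact: q_neq0.
  (* Here q = p x - sigma_i^n_i(x) p, and the formula at x says that q(T_a) kills 1. *)
  move=> a; set q := _ - _; suff <- : uniore_op delta i q a 1 = 0.
    exact: uniore_evalE.
  rewrite /q -scaleN1r uniore_opD !uniore_opZ uniore_op_rmulC mulr1 opE.
  by rewrite mulN1r subrr.
split=> // lead_comm; split=> // -[_ semi_p] a x /=.
have [x'] := semi_p x.
rewrite -uniore_rmulC scalarM -unioreZ => /uniore_inj px.
have -> : iter n_i (sigma i) x = x'.
  have lead_unit : lead_coef p \is a GRing.unit by apply: Kdiv; rewrite lead_coef_eq0.
  apply: (mulIr lead_unit).
  by rewrite -lead_comm -(coef_rmulC_lead delta i) px coefZ lead_coefE.
(* Both sides of p x = x' p act on 1. *)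
by rewrite -[in LHS](mulr1 x) -uniore_op_rmulC px uniore_opZ.
Qed.
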